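(* Let $x_* \in \mathrm{dom}(g)$ be a solution of the composite minimization problem $\min_{x\in\mathbb{R}^n} F(x)=\bar f(x)+g(x)$, and let the sequence $(x_k)_{k\ge 0}$ be generated by the Regularized Quasi-Monotone Method (RQM) with control parameters $$a_k=1,\qquad \gamma_k=\sqrt{k+1},\qquad k\ge 0.$$ Assume that the subgradient estimates have uniformly bounded second moments: there exists $G>0$ with $\mathbb{E}\left[\|w(x,\xi)\|_*^2\right]\le G^2$ for all $x\in\mathrm{dom}(\bar f)$. Then for all $k\ge 0$: $$\mathbb{E}\left[F(x_k)\right]-F(x_* )\;\le\;\left(\Psi(x_* )+\frac{G^2}{\beta}\right)\frac{1}{\sqrt{k+1}}.$$
   Context: Problem: $\bar f,g:\mathbb{R}^n\to\mathbb{R}\cup\{+\infty\}$ are closed convex functions and $\bar f(x)=\mathbb{E}[f(x,\xi)]$, where $f$ is closed and convex in its first argument and $\xi$ is a random sample from a random space $\Xi$. It is assumed that $\mathrm{dom}(f(\cdot,\xi))\subset\mathrm{dom}(g)$ for a.e. $\xi$, and that $\mathrm{dom}(g)$ is closed. $\|\cdot\|$ is an arbitrary fixed norm on $\mathbb{R}^n$ and $\|\cdot\|_*$ is its dual norm. The function $g$ is strongly convex with parameter $\sigma\ge 0$ with respect to $\|\cdot\|$, i.e. $g(\alpha x+(1-\alpha)y)\le \alpha g(x)+(1-\alpha)g(y)-\frac{\sigma}{2}\alpha(1-\alpha)\|x-y\|^2$ for $x,y\in\mathrm{dom}(g)$, $\alpha\in[0,1]$ ($\sigma=0$ is mere convexity).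 Stochastic subgradients: for every $x\in\mathrm{dom}(g)$ an unbiased finite-variance subgradient estimate $w(x,\xi)$ is available, with $\mathbb{E}[w(x,\xi)]\in\partial\bar f(x)$ (convex subdifferential). Prox-function: $\Psi:\mathbb{R}^n\to\mathbb{R}\cup\{+\infty\}$ is a prox-function for $\mathrm{dom}(g)$, meaning: $\Psi(x)\ge 0$ for all $x\in\mathrm{dom}(g)$; $\Psi$ is strongly convex on $\mathrm{dom}(g)$ with parameter $\beta>0$, i.e. $\Psi(\alpha x+(1-\alpha)y)\le\alpha\Psi(x)+(1-\alpha)\Psi(y)-\frac{\beta}{2}\alpha(1-\alpha)\|x-y\|^2$ for all $x,y\in\mathrm{dom}(g)$, $\alpha\in[0,1]$; and the problem $\min_x\{\langle s,x\rangle+g(x)+\gamma\Psi(x)\}$ is (easily) solvable for every $s\in\mathbb{R}^n$ and $\gamma>0$. Method (RQM), for positive parameters $(a_k)_{k\ge0}$, positive nondecreasing $(\gamma_k)_{k\ge0}$, and $A_k=\sum_{\ell=0}^k a_\ell$: initialize $x_0=\arg\min_x\{A_0g(x)+\gamma_0\Psi(x)\}$, $s_{-1}=0$. For $k=0,1,2,\dots$: (1) sample $\xi_k\sim\Xi$ (the samples $\xi_0,\xi_1,\dots$ are independent copies of $\xi$); (2) compute $w(x_k,\xi_k)$ and set $s_k=s_{k-1}+a_kw(x_k,\xi_k)$; (3) set $x_k^+=\arg\min_x\{\langle s_k,x\rangle+A_{k+1}g(x)+\gamma_{k+1}\Psi(x)\}$; (4) set $x_{k+1}=\frac{A_k}{A_{k+1}}x_k+\frac{a_{k+1}}{A_{k+1}}x_k^+$.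 The expectation $\mathbb{E}[F(x_k)]$ is over all the samples. *)

(* Defs.v *)
From HB Require Import structures.
From mathcomp Require Import all_boot all_order all_algebra.
From mathcomp Require Import all_classical all_reals all_analysis.
From mathcomp Require Import measurable_realfun.

Set Implicit Arguments.
Unset Strict Implicit.
Unset Printing Implicit Defensive.

Import Order.TTheory GRing.Theory Num.Theory.
Import numFieldNormedType.Exports.

Local Open Scope classical_set_scope.
Local Open Scope ring_scope.

Section convex_analysis.
Context {R : realType} {n : nat}.
Implicit Types (h : 'rV[R]_n -> \bar R) (N : 'rV[R]_n -> R).

Definition inner (s x : 'rV[R]_n) : R := \sum_(i < n) s 0 i * x 0 i.

Definition is_norm N : Prop :=
  [/\ forall x y, N (x + y) <= N x + N y,
      forall (a : R) x, N (a *: x) = `|a| * N x &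
      forall x, N x = 0 -> x = 0].

Definition dual_norm N (s : 'rV[R]_n) : R :=
  sup [set inner s x | x in [set x | N x <= 1]].

Definition dom h : set 'rV[R]_n := [set x | (h x < +oo)%E].

(* Functions into R u {+oo} are maps to \bar R that avoid -oo.  Since
   0 * +oo = 0 in \bar R, the cases t = 0 and t = 1 hold trivially. *)
Definition convex_fun h : Prop :=
  forall x y (t : R), 0 <= t <= 1 ->
    (h (t *: x + (1 - t) *: y)%R <= t%:E * h x + (1 - t)%:E * h y)%E.

Definition closed_fun h : Prop :=
  closed [set p : 'rV[R]_n * R | (h p.1 <= p.2%:E)%E].

Definition closed_convex h : Prop :=
  [/\ forall x, h x != -oo%E, convex_fun h & closed_fun h].

Definition strongly_convex_on N (C : set 'rV[R]_n) (mu : R) h : Prop :=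
  forall x y (t : R), C x -> C y -> 0 <= t <= 1 ->
    (h (t *: x + (1 - t) *: y)%R <= t%:E * h x + (1 - t)%:E * h y
       - (mu / 2 * t * (1 - t) * N (x - y) ^+ 2)%:E)%E.

Definition subdifferential h (x : 'rV[R]_n) : set 'rV[R]_n :=
  [set s | dom h x /\ forall y, (h x + (inner s (y - x))%:E <= h y)%E].

Definition minimizer h (x : 'rV[R]_n) : Prop := forall y, (h x <= h y)%E.

Definition prox_objective (g Psi : 'rV[R]_n -> \bar R) (s : 'rV[R]_n)
    (A gamma : R) (x : 'rV[R]_n) : \bar R :=
  ((inner s x)%:E + A%:E * g x + gamma%:E * Psi x)%E.

Definition prox_function N g (beta : R) (Psi : 'rV[R]_n -> \bar R) : Prop :=
  [/\ forall x, Psi x != -oo%E,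
      forall x, dom g x -> (0 <= Psi x)%E,
      0 < beta,
      strongly_convex_on N (dom g) beta Psi &
      forall s (gamma : R), 0 < gamma ->
        exists x, minimizer (prox_objective g Psi s 1 gamma) x].

End convex_analysis.

(* R^n with its Borel sigma-algebra. *)
Definition borel_rV (R : realType) (n : nat) :=
  g_sigma_algebraType (@open 'rV[R]_n).

Section stochastic.
Context {R : realType} {n : nat} {d : measure_display} {Xi : measurableType d}.

(* With MathComp-Analysis's convention +oo - oo = -oo, the integral is
   different from -oo iff the negative part of f x is integrable. *)
Definition expected_fun (D : probability Xi R)
    (f : 'rV[R]_n -> Xi -> \bar R) (x : 'rV[R]_n) : \bar R :=
  (\int[D]_z f x z)%E.

Definition composite (D : probability Xi R) (f : 'rV[R]_n -> Xi -> \bar R)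
    (g : 'rV[R]_n -> \bar R) (x : 'rV[R]_n) : \bar R :=
  (expected_fun D f x + g x)%E.

Definition mean (D : probability Xi R) (v : Xi -> 'rV[R]_n) : 'rV[R]_n :=
  \row_i fine 'E_D[fun z => v z 0 i].

(* Joint measurability on dom g x Xi is what makes the iterates of the method
   random vectors. *)
Definition subgradient_oracle (D : probability Xi R)
    (fbar g : 'rV[R]_n -> \bar R) (w : 'rV[R]_n -> Xi -> 'rV[R]_n) : Prop :=
  @measurable_fun _ _ (borel_rV R n * Xi)%type (borel_rV R n)
    (dom g `*` [set: Xi]) (fun p => w p.1 p.2) /\
  forall x, dom g x ->
    [/\ forall i, (fun z => w x z 0 i) \in Lfun D 1,
        forall i, ('V_D[fun z => (w x z 0 i)%R] < +oo)%E &
        subdifferential fbar x (mean D (w x))].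

Definition iid_samples {d' : measure_display} {Omega : measurableType d'}
    (P : probability Omega R) (D : probability Xi R)
    (xi : nat -> {RV P >-> Xi}) : Prop :=
  (forall k (B : set Xi), measurable B -> distribution P (xi k) B = D B) /\
  (forall (J : seq nat) (B : nat -> set Xi), uniq J ->
    (forall j, j \in J -> measurable (B j)) ->
    P (\bigcap_(j in [set` J]) (xi j @^-1` B j)) =
      (\prod_(j <- J) P (xi j @^-1` B j))%E).

Definition weight_sum (a : nat -> R) (k : nat) : R := \sum_(l < k.+1) a l.

(* z is the realised sample path and x the resulting sequence of iterates;
   s k and xp k stand for s_k and x_k^+, with s_{-1} = 0. *)
Definition RQM (a gamma : nat -> R) (g Psi : 'rV[R]_n -> \bar R)
    (w : 'rV[R]_n -> Xi -> 'rV[R]_n) (z : nat -> Xi)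
    (x : nat -> 'rV[R]_n) : Prop :=
  let A := weight_sum a in
  exists s xp : nat -> 'rV[R]_n,
  [/\ minimizer (prox_objective g Psi 0 (A 0%N) (gamma 0%N)) (x 0%N),
      forall k, s k = (if k is j.+1 then s j else 0) + a k *: w (x k) (z k),
      forall k, minimizer
        (prox_objective g Psi (s k) (A k.+1) (gamma k.+1)) (xp k) &
      forall k, x k.+1 =
        (A k / A k.+1) *: x k + (a k.+1 / A k.+1) *: xp k].

End stochastic.

(* Main.v *)
Require Import Defs.
From HB Require Import structures.
From mathcomp Require Import all_boot all_order all_algebra.
From mathcomp Require Import all_classical all_reals all_analysis.
From mathcomp Require Import measurable_realfun ring lra.

Import Order.TTheory GRing.Theory Num.Theory.
Import numFieldNormedType.Exports.

Local Open Scope classical_set_scope.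
Local Open Scope ring_scope.

(* Write v_l for the minimizer of Phi_l(y) = <s_(l-1), y> + (l+1) g(y) + gamma_l Psi(y),
   so that x_k is the average of v_0, ..., v_k.  Strong convexity of Phi_l and Young's
   inequality give the regularized dual averaging bound
     sum_(l <= k) (<w_l, v_l - y> + g(v_l) - g(y))
       <= gamma_k Psi(y) + sum_(l <= k) |w_l|_*^2 / (2 beta gamma_l).
   Let m_l be the mean of w(x_l, .), a subgradient of fbar at x_l.  Since
   v_(l+1) = (l+2) x_(l+1) - (l+1) x_l, convexity telescopes to
     (k+1) (F(x_k) - F(y)) <= sum_(l <= k) (<m_l, v_l - y> + g(v_l) - g(y)).
   The two sums differ by <m_l - w_l, v_l - y>, which has mean zero: x_l and v_l
   depend on xi_0, ..., xi_(l-1) only (v_l is a Lipschitz function of s_(l-1)), hence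
   are independent of xi_l. *)

(** * Norms on R^n and their duals *)

Section inner_product.
Context {R : realType} {n : nat}.
Implicit Types s t x y : 'rV[R]_n.

Lemma innerC s x : inner s x = inner x s.
Proof. by apply: eq_bigr => i _; rewrite mulrC. Qed.

Lemma innerDl s t x : inner (s + t) x = inner s x + inner t x.
Proof. by rewrite -big_split; apply: eq_bigr => i _; rewrite mxE mulrDl. Qed.

Lemma innerZl (a : R) s x : inner (a *: s) x = a * inner s x.
Proof. by rewrite /inner mulr_sumr; apply: eq_bigr => i _; rewrite mxE mulrA. Qed.

Lemma innerDr s x y : inner s (x + y) = inner s x + inner s y.
Proof. by rewrite innerC innerDl !(innerC s). Qed.

Lemma innerZr (a : R) s x : inner s (a *: x) = a * inner s x.
Proof. by rewrite innerC innerZl innerC. Qed.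

Lemma innerNl s x : inner (- s) x = - inner s x.
Proof. by rewrite -scaleN1r innerZl mulN1r. Qed.

Lemma innerNr s x : inner s (- x) = - inner s x.
Proof. by rewrite innerC innerNl innerC. Qed.

Lemma innerBl s t x : inner (s - t) x = inner s x - inner t x.
Proof. by rewrite innerDl innerNl. Qed.

Lemma innerBr s x y : inner s (x - y) = inner s x - inner s y.
Proof. by rewrite innerDr innerNr. Qed.

Lemma inner0r s : inner s 0 = 0.
Proof. by rewrite -(scale0r 0) innerZr mul0r. Qed.

Lemma inner0l s : inner 0 s = 0.
Proof. by rewrite innerC inner0r. Qed.

Lemma inner_suml I (r : seq I) (F : I -> 'rV[R]_n) x :
  inner (\sum_(i <- r) F i) x = \sum_(i <- r) inner (F i) x.
Proof.
by elim: r => [|i r IH]; rewrite ?big_nil ?inner0l// !big_cons innerDl IH.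
Qed.

Lemma row_coord_le x i : `|x 0 i| <= `|x|.
Proof.
rewrite [leRHS]/Num.norm /= mx_normrE; apply/bigmax_geP; right => /=.
by exists (0, i).
Qed.

Lemma inner_le s x : `|inner s x| <= n%:R * `|s| * `|x|.
Proof.
apply: (le_trans (ler_norm_sum _ _ _)).
apply: (@le_trans _ _ (\sum_(i < n) `|s| * `|x|)).
  by apply: ler_sum => i _; rewrite normrM ler_pM ?row_coord_le.
by rewrite sumr_const card_ord -mulrA mulr_natl.
Qed.

End inner_product.

Lemma lip_continuous {R : realType} {V W : normedModType R} {C : R} (f : V -> W) :
  (forall x y, `|f x - f y| <= C * `|x - y|) -> continuous f.
Proof.
move=> fC x; apply/cvgrPdist_lt => e e0.
have D0 : 0 < `|C| + 1 by rewrite ltr_pwDr.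
near=> y; apply: (le_lt_trans (fC x y)).
apply: (@le_lt_trans _ _ ((`|C| + 1) * `|x - y|)).
  by rewrite ler_wpM2r// (le_trans (ler_norm _))// lerDl.
rewrite mulrC -ltr_pdivlMr//.
by near: y; apply: cvgr_dist_lt => //; rewrite divr_gt0.
Unshelve. all: by end_near. Qed.

Section norms.
Context {R : realType} {n : nat} {N : 'rV[R]_n -> R}.
Hypothesis hN : is_norm N.
Implicit Types s t x y : 'rV[R]_n.

Let ND x y : N (x + y) <= N x + N y. Proof. by case: hN. Qed.
Let NZ (a : R) x : N (a *: x) = `|a| * N x. Proof. by case: hN. Qed.

Lemma is_norm0 : N 0 = 0.
Proof. by rewrite -(scale0r 0) NZ normr0 mul0r. Qed.

Lemma is_normN x : N (- x) = N x.
Proof. by rewrite -scaleN1r NZ normrN1 mul1r. Qed.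

Lemma is_norm_ge0 x : 0 <= N x.
Proof. by have := ND x (- x); rewrite subrr is_norm0 is_normN; lra. Qed.

Lemma is_norm_gt0 x : x != 0 -> 0 < N x.
Proof.
move=> x0; rewrite lt_neqAle is_norm_ge0 andbT eq_sym; apply: contra x0.
by case: hN => _ _ h /eqP/h ->.
Qed.

(** Expand [x] in the standard basis and apply the triangle inequality; [C] is the sum of the values
    of [N] at the basis vectors. *)
Lemma is_norm_ub : exists2 C : R, 0 <= C & forall x, N x <= C * `|x|.
Proof.
exists (\sum_(i < n) N (delta_mx 0 i)); first exact/sumr_ge0/(fun i _ =>
  is_norm_ge0 _).
move=> x; rewrite {1}(row_sum_delta x).
have NS (r : seq 'I_n) : N (\sum_(i <- r) x 0 i *: delta_mx 0 i) <=
    \sum_(i <- r) N (delta_mx 0 i) * `|x|.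
  elim: r => [|i r IH]; first by rewrite !big_nil is_norm0.
  rewrite !big_cons (le_trans (ND _ _))// lerD// NZ mulrC ler_wpM2l ?is_norm_ge0//.
  exact: row_coord_le.
by rewrite mulr_suml; exact: NS.
Qed.

Lemma is_norm_lip : exists2 C : R, 0 <= C & forall x y, `|N x - N y| <= C * `|x - y|.
Proof.
have [C C0 NC] := is_norm_ub; exists C => // x y.
have := ND (x - y) y; have := ND (y - x) x; rewrite !subrK -(is_normN (y - x)) opprB.
by have := NC (x - y); rewrite ler_norml; lra.
Qed.

Lemma is_norm_continuous : continuous N.
Proof. by have [C _ NC] := is_norm_lip; exact: lip_continuous NC. Qed.

(** The unit sphere of the sup norm is compact and [N] is continuous and positive on it, so [1 / N]
    is bounded there; homogeneity extends the bound to R^n. Together with [is_norm_ub] this makes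
    [N] equivalent to the sup norm. *)
Lemma is_norm_lb : exists2 C : R, 0 <= C & forall x, `|x| <= C * N x.
Proof.
pose S := [set x : 'rV[R]_n | `|x| = 1].
have cS : compact S.
  apply: bounded_closed_compact.
    by exists 1; split => // M M1 x /= ->; exact: ltW.
  apply: (@closed_comp _ _ (fun x : 'rV[R]_n => `|x|) [set 1]).
    by move=> x _; exact: norm_continuous.
  exact: closed_eq.
have S0 x : S x -> x != 0.
  by move=> Sx; rewrite -normr_eq0 Sx oner_eq0.
have cN : {within S, continuous (fun x => (N x)^-1)}.
  apply: continuous_in_subspaceT => x /set_mem Sx.
  have Nx0 : N x != 0 by rewrite gt_eqF// is_norm_gt0// S0.
  exact: (cvgV Nx0 (is_norm_continuous x)).
have [M [_ SM]] := compact_bounded (continuous_compact cN cS).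
have {}SM x : S x -> (N x)^-1 <= `|M| + 1.
  move=> Sx; have := SM (`|M| + 1) _ (N x)^-1 (ex_intro2 _ _ x Sx erefl).
  rewrite ltr_pwDr ?ler_norm// => /(_ isT); apply: le_trans; exact: ler_norm.
exists (`|M| + 1) => [|x]; first by rewrite addr_ge0.
have [->|x0] := eqVneq x 0; first by rewrite normr0 is_norm0 mulr0.
have nx : 0 < `|x| by rewrite normr_gt0.
have /SM : S (`|x|^-1 *: x).
  by rewrite /S /= normrZ normrV ?unitfE ?gt_eqF// normr_id mulVf ?gt_eqF.
rewrite NZ normrV ?unitfE ?gt_eqF// normr_id invfM invrK.
by rewrite ler_pdivrMr// is_norm_gt0.
Qed.

(** A real [sup] is meaningful only on a nonempty set that is bounded above. Boundedness holds
    because the unit ball of [N] is bounded in the sup norm. *)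
Lemma dual_norm_has_sup s :
  has_sup [set inner s x | x in [set x | N x <= 1]].
Proof.
split; first by exists 0; exists 0; rewrite /= ?is_norm0 ?inner0r.
have [C C0 NC] := is_norm_lb.
exists (n%:R * `|s| * C) => _ [x /= Nx <-].
apply: (le_trans (ler_norm _)); apply: (le_trans (inner_le _ _)).
rewrite ler_wpM2l ?mulr_ge0//; apply: (le_trans (NC x)).
by rewrite -[leRHS]mulr1 ler_wpM2l.
Qed.

Lemma dual_norm_ub s x : inner s x <= dual_norm N s * N x.
Proof.
have [->|x0] := eqVneq x 0; first by rewrite inner0r is_norm0 mulr0.
have Nx := is_norm_gt0 _ x0.
rewrite -ler_pdivrMr// mulrC -innerZr.
apply: ub_le_sup; first by case: (dual_norm_has_sup s).
by exists ((N x)^-1 *: x) => //=; rewrite NZ gtr0_norm ?invr_gt0// mulVf ?gt_eqF.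
Qed.

Lemma dual_norm_le s M :
  (forall x, N x <= 1 -> inner s x <= M) -> dual_norm N s <= M.
Proof.
move=> sM; apply: ge_sup; first by case: (dual_norm_has_sup s).
by move=> _ [x /= Nx <-]; exact: sM.
Qed.

Lemma dual_norm_ge0 s : 0 <= dual_norm N s.
Proof.
apply: ub_le_sup; first by case: (dual_norm_has_sup s).
by exists 0; rewrite /= ?is_norm0 ?inner0r.
Qed.

Lemma dual_norm_abs s x : `|inner s x| <= dual_norm N s * N x.
Proof.
rewrite ler_norml dual_norm_ub andbT lerNl -innerNr.
by rewrite (le_trans (dual_norm_ub _ _))// is_normN.
Qed.

Lemma dual_norm0 : dual_norm N 0 = 0.
Proof.
by apply/eqP; rewrite eq_le dual_norm_ge0 andbT dual_norm_le// => x _; rewrite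
  inner0l.
Qed.

Lemma dual_norm_triangle s t :
  dual_norm N (s + t) <= dual_norm N s + dual_norm N t.
Proof.
apply: dual_norm_le => x Nx; rewrite innerDl lerD//.
- by rewrite (le_trans (dual_norm_ub _ _))// ler_piMr// dual_norm_ge0.
- by rewrite (le_trans (dual_norm_ub _ _))// ler_piMr// dual_norm_ge0.
Qed.

Lemma dual_norm_bound :
  exists2 C : R, 0 <= C & forall s, dual_norm N s <= C * `|s|.
Proof.
have [C C0 NC] := is_norm_lb.
exists (n%:R * C) => [|s]; first by rewrite mulr_ge0.
apply: dual_norm_le => x Nx.
apply: (le_trans (ler_norm _)); apply: (le_trans (inner_le _ _)).
rewrite mulrAC ler_wpM2r// ler_wpM2l// (le_trans (NC x))//.
by rewrite -[leRHS]mulr1 ler_wpM2l.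
Qed.

(** The triangle inequality and [dual_norm_bound] make the dual norm Lipschitz for the sup norm.
    Continuity serves later to measure the norms of random vectors. *)
Lemma dual_norm_continuous : continuous (dual_norm N).
Proof.
have [C C0 dC] := dual_norm_bound; apply: (@lip_continuous _ _ _ C) => s t.
have := dual_norm_triangle (s - t) t; have := dual_norm_triangle (t - s) s.
rewrite !subrK; have := dC (s - t); have := dC (t - s).
by rewrite distrC ler_norml; lra.
Qed.

End norms.

(** * Deterministic estimates *)

Section dual_averaging.
Context {R : realType} {n : nat} {N : 'rV[R]_n -> R}.
Hypothesis hN : is_norm N.
Context {C : set 'rV[R]_n} {h p : 'rV[R]_n -> R} {beta : R}.
Hypothesis convC : forall x y (t : R), C x -> C y -> 0 <= t <= 1 ->
  C (t *: x + (1 - t) *: y).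
Hypothesis convh : forall x y (t : R), C x -> C y -> 0 <= t <= 1 ->
  h (t *: x + (1 - t) *: y) <= t * h x + (1 - t) * h y.
Hypothesis convp : forall x y (t : R), C x -> C y -> 0 <= t <= 1 ->
  p (t *: x + (1 - t) *: y) <=
    t * p x + (1 - t) * p y - beta / 2 * t * (1 - t) * N (x - y) ^+ 2.
Hypothesis p_ge0 : forall x, C x -> 0 <= p x.
Hypothesis beta_gt0 : 0 < beta.

(** Real-valued counterpart of [prox_objective]: [h] and [p] stand for [g] and [Psi] on a convex set
    [C] where both are finite. *)
Definition regularized (s : 'rV[R]_n) (A c : R) x := inner s x + A * h x + c * p x.

Definition argmin_on (D : set 'rV[R]_n) (phi : 'rV[R]_n -> R) v :=
  D v /\ forall y, D y -> phi v <= phi y.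

(** Compare [v] with the points [t y + (1 - t) v]. Minimality and strong convexity, after division
    by [t], bound [q (1 - t)] by the difference of the objective values for every [t] in (0, 1];
    small [t] then suffices. *)
Lemma argmin_growth s (A c : R) v y : 0 <= A -> 0 < c ->
  argmin_on C (regularized s A c) v -> C y ->
  regularized s A c v + c * beta / 2 * N (y - v) ^+ 2 <= regularized s A c y.
Proof.
move=> A0 c0 [Cv vmin] Cy; set q := c * beta / 2 * _; rewrite -lerBrDl.
have q0 : 0 <= q.
  by rewrite /q mulr_ge0 ?sqr_ge0// divr_ge0// mulr_ge0// ltW.
have key t : 0 < t -> t <= 1 ->
    q * (1 - t) <= regularized s A c y - regularized s A c v.
  move=> t0 t1; have t01 : 0 <= t <= 1 by rewrite ltW.
  have := vmin _ (convC _ _ _ Cy Cv t01).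
  have := convh _ _ _ Cy Cv t01; have := convp _ _ _ Cy Cv t01.
  move=> /(ler_wpM2l (ltW c0)) hp /(ler_wpM2l A0) hh.
  rewrite /regularized innerDr !innerZr /q => hv.
  by rewrite -(ler_pM2l t0); lra.
rewrite leNgt; apply/negP => qlt.
have d0 : 0 <= regularized s A c y - regularized s A c v.
  by rewrite subr_ge0 vmin.
set e := regularized s A c y - _ in key qlt d0.
have q1 : 0 < q by lra.
(* This value of [t] replaces the limit at 0: it makes [q (1 - t)] equal to [(q + e) / 2], which
   exceeds [e] as soon as [e < q]. *)
have t0 : 0 < (q - e) / (2 * q) by rewrite divr_gt0; lra.
have t1 : (q - e) / (2 * q) <= 1 by rewrite ler_pdivrMr; lra.
have := key _ t0 t1.
have -> : q * (1 - (q - e) / (2 * q)) = (q + e) / 2 by field; rewrite gt_eqF.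
lra.
Qed.

(** Add the growth inequality of each minimizer evaluated at the other. The terms in [h] and [p]
    cancel, which leaves [c beta N(v - v')^2 <= <s - s', v' - v>]; then bound the right side by the
    dual norm. *)
Lemma argmin_lip s s' (A c : R) v v' : 0 <= A -> 0 < c ->
  argmin_on C (regularized s A c) v -> argmin_on C (regularized s' A c) v' ->
  c * beta * N (v - v') <= dual_norm N (s - s').
Proof.
move=> A0 c0 mv mv'.
have := argmin_growth _ _ _ _ _ A0 c0 mv (proj1 mv').
have := argmin_growth _ _ _ _ _ A0 c0 mv' (proj1 mv).
have cb : 0 < c * beta by rewrite mulr_gt0.
rewrite /regularized -(is_normN hN (v' - v)) opprB => h1 h2.
have := dual_norm_ub hN (s - s') (v' - v).
rewrite -(is_normN hN (v' - v)) opprB innerBl !innerBr => h3.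
have [->|vv] := eqVneq (v - v') 0; first by rewrite (is_norm0 hN) mulr0
  (dual_norm_ge0 hN).
have Nv := is_norm_gt0 hN _ vv.
by rewrite -(ler_pM2r Nv); lra.
Qed.

Lemma argmin_unique s (A c : R) v v' : 0 <= A -> 0 < c ->
  argmin_on C (regularized s A c) v -> argmin_on C (regularized s A c) v' -> v = v'.
Proof.
move=> A0 c0 mv mv'; have := argmin_lip _ _ _ _ _ _ A0 c0 mv mv'.
rewrite subrr (dual_norm0 hN) pmulr_rle0 ?mulr_gt0// => Nv.
apply/eqP; rewrite -subr_eq0; apply: contraLR Nv => /(is_norm_gt0 hN).
by rewrite -ltNge.
Qed.

(** The Lipschitz estimate of [argmin_lip] passes to the sup norm by equivalence of norms.
    Continuity of the solution map is what makes the points [v_l] measurable. *)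
Lemma argmin_continuous (A c : R) (V : 'rV[R]_n -> 'rV[R]_n) : 0 <= A -> 0 < c ->
  (forall s, argmin_on C (regularized s A c) (V s)) -> continuous V.
Proof.
move=> A0 c0 mV; have cb : 0 < c * beta by rewrite mulr_gt0.
have [C1 C10 NC1] := is_norm_lb hN; have [C2 C20 dC2] := dual_norm_bound hN.
apply: (@lip_continuous _ _ _ (C1 * ((c * beta)^-1 * C2))) => s t.
apply: (le_trans (NC1 _)); rewrite -!mulrA ler_wpM2l// ler_pdivlMl//.
exact: le_trans (argmin_lip _ _ _ _ _ _ A0 c0 (mV s) (mV t)) (dC2 _).
Qed.

(** Expand the square of [c N(u) - dual_norm N w]. *)
Lemma young_dual (c : R) w u : 0 < c ->
  - (dual_norm N w ^+ 2 / (2 * c)) <= inner w u + c / 2 * N u ^+ 2.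
Proof.
move=> c0; have := dual_norm_abs hN w u; rewrite ler_norml => /andP[h1 _].
have : 0 <= (c * N u - dual_norm N w) ^+ 2 / (2 * c).
  by rewrite divr_ge0 ?sqr_ge0//; lra.
have -> : (c * N u - dual_norm N w) ^+ 2 / (2 * c) =
  c / 2 * N u ^+ 2 - dual_norm N w * N u + dual_norm N w ^+ 2 / (2 * c).
  by field; rewrite gt_eqF.
lra.
Qed.

(** The minimal values of the successive objectives [Phi l] serve as a potential, which is bounded
    below by induction and above through the comparison point [y]. *)
Lemma dual_averaging_bound (gam : nat -> R) (W v : nat -> 'rV[R]_n) (y : 'rV[R]_n) k :
  (forall l, 0 < gam l) -> (forall l, gam l <= gam l.+1) ->
  (forall l, argmin_on C (regularized (\sum_(j < l) W j) l.+1%:R (gam l)) (v l)) ->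
  C y ->
  \sum_(l < k.+1) (inner (W l) (v l - y) + (h (v l) - h y)) <=
    gam k * p y + \sum_(l < k.+1) dual_norm N (W l) ^+ 2 / (2 * (gam l * beta)).
Proof.
move=> gam0 gamS mv Cy.
pose Phi l := regularized (\sum_(j < l) W j) l.+1%:R (gam l).
pose E l := dual_norm N (W l) ^+ 2 / (2 * (gam l * beta)).
(* Replacing [v l] by [z] costs at most [E l]: the quadratic growth of [Phi l] around [v l] absorbs
   the change of the new linear term, by Young's inequality with constant [gam l * beta]. *)
have step l z : C z -> Phi l (v l) + inner (W l) (v l) - E l <= Phi l z + inner (W
  l) z.
  move=> Cz; have := argmin_growth _ _ _ _ _ (ler0n _ _) (gam0 l) (mv l) Cz.
  have := young_dual (gam l * beta) (W l) (z - v l) (mulr_gt0 (gam0 l) beta_gt0).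
  by rewrite innerBr /Phi /E; lra.
(* In [Phi l] the weight of [h] is l + 1 while the sum runs over j < l; the extra [h (v l)] balances
   the count. Passing from l to l + 1 uses that [gam] is nondecreasing and [p] nonnegative. *)
have ind l : \sum_(j < l) (inner (W j) (v j) + h (v j) - E j) + h (v l) <= Phi l (v
  l).
  elim: l => [|l IH].
    rewrite /Phi /regularized !big_ord0 inner0l mul1r !add0r lerDl.
    by rewrite mulr_ge0 ?p_ge0 ?(ltW (gam0 _))//; case: (mv 0%N).
  rewrite big_ord_recr /=.
  have Cv : C (v l.+1) by case: (mv l.+1).
  have := step l _ Cv.
  have : 0 <= (gam l.+1 - gam l) * p (v l.+1).
    by rewrite mulr_ge0 ?p_ge0// subr_ge0.
  rewrite /Phi /regularized in IH *; rewrite (big_ord_recr l) /= innerDl.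
  rewrite [l.+2%:R]mulrS; lra.
have linear_part : \sum_(l < k.+1) inner (W l) (v l - y) =
    \sum_(l < k.+1) inner (W l) (v l) - inner (\sum_(l < k.+1) W l) y.
  under eq_bigr do rewrite innerBr.
  by rewrite sumrB inner_suml.
have value_part : \sum_(l < k.+1) (h (v l) - h y) =
    \sum_(l < k.+1) h (v l) - k.+1%:R * h y.
  by rewrite sumrB sumr_const card_ord mulr_natl.
rewrite big_split /= linear_part value_part.
(* Closing with [step k] at [y], rather than with [ind k.+1], keeps the coefficient [gam k] in front
   of [p y]. *)
have := ind k; have := step k y Cy.
rewrite sumrB big_split /= !(big_ord_recr k) /= innerDl -/(E k) /Phi /regularized.
by rewrite /E; lra.
Qed.

End dual_averaging.

(** * Telescoping along averaged iterates *)

Section quasi_monotone.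
Context {R : realType} {n : nat}.
Context {C : set 'rV[R]_n} {h : 'rV[R]_n -> R}.
Hypothesis convC : forall x y (t : R), C x -> C y -> 0 <= t <= 1 ->
  C (t *: x + (1 - t) *: y).
Hypothesis convh : forall x y (t : R), C x -> C y -> 0 <= t <= 1 ->
  h (t *: x + (1 - t) *: y) <= t * h x + (1 - t) * h y.
Variables x v : nat -> 'rV[R]_n.
Hypothesis x0 : x 0%N = v 0%N.
Hypothesis xS : forall k, x k.+1 = (k.+1%:R / k.+2%:R) *: x k + (1 / k.+2%:R) *: v
  k.+1.
Hypothesis Cv : forall k, C (v k).

Let ratio k : (1 / k.+2%:R : R) = 1 - k.+1%:R / k.+2%:R.
Proof.
have k2 : k.+2%:R != 0 :> R by rewrite pnatr_eq0.
by apply: (mulIf k2); rewrite mulrBl !divfK// [k.+2%:R]mulrS mul1r addrK.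
Qed.

Let ratio01 k : 0 <= (k.+1%:R / k.+2%:R : R) <= 1.
Proof. by rewrite divr_ge0//= ler_pdivrMr// mul1r ler_nat. Qed.

Lemma averaged_iterate_in k : C (x k).
Proof.
by elim: k => [|k IH]; [rewrite x0|rewrite xS ratio; exact: convC].
Qed.

Lemma averaged_iterate k : v k.+1 = k.+2%:R *: x k.+1 - k.+1%:R *: x k.
Proof.
rewrite xS scalerDr !scalerA mulrC divfK ?pnatr_eq0// mul1r divff ?pnatr_eq0//.
by rewrite scale1r addrC addKr.
Qed.

(** Since [v_(k+1) - y = (x_(k+1) - y) + (k+1) (x_(k+1) - x_k)], the subgradient inequality at
    [x_(k+1)], taken towards [y] and k + 1 times towards [x_k], makes the [phi] part telescope. For
    [h] the same recursion comes from convexity, as [x_(k+1)] is a convex combination of [x_k] and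
    [v_(k+1)]. *)
Lemma quasi_monotone_bound (phi : 'rV[R]_n -> R) (m : nat -> 'rV[R]_n) y k :
  (forall l z, C z -> phi (x l) + inner (m l) (z - x l) <= phi z) -> C y ->
  k.+1%:R * (phi (x k) + h (x k) - (phi y + h y)) <=
    \sum_(l < k.+1) (inner (m l) (v l - y) + (h (v l) - h y)).
Proof.
move=> sub Cy; elim: k => [|k IH].
  rewrite big_ord1 mul1r -x0; have := sub 0%N y Cy.
  by rewrite !innerBr; lra.
rewrite big_ord_recr /= (averaged_iterate k).
have := sub k.+1 y Cy; have := sub k.+1 _ (averaged_iterate_in k).
have := convh _ _ _ (averaged_iterate_in k) (Cv k.+1) (ratio01 k).
rewrite -ratio -xS => hh.
have k1 : 0 < k.+1%:R :> R by [].
have k2 : 0 < k.+2%:R :> R by [].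
have {}hh : k.+2%:R * h (x k.+1) <= k.+1%:R * h (x k) + h (v k.+1).
  by rewrite -ler_pdivlMl// mulrDr mulrA (mulrC _^-1); rewrite div1r in hh.
move=> /(ler_wpM2l (ltW k1)) hx hy; apply: le_trans (lerD IH (lexx _)).
rewrite -averaged_iterate in hx hy *.
rewrite (innerBr _ _ y) {1}averaged_iterate innerBr !innerZr.
rewrite !innerBr in hx hy.
rewrite [k.+2%:R]mulrS in hh *; lra.
Qed.

End quasi_monotone.

(** * From extended-valued functions to real ones on their common domain *)

Section prox.
Context {R : realType} {n : nat} {N : 'rV[R]_n -> R}.
Context {g Psi : 'rV[R]_n -> \bar R} {beta : R}.
Hypothesis hg : closed_convex g.
Hypothesis hPsi : prox_function N g beta Psi.

(** [Psi] may be infinite at points of [dom g]; the prox objectives with positive weights are finite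
    exactly on this intersection. *)
Definition prox_dom := dom g `&` dom Psi.
Local Notation S := prox_dom.
Local Notation h := (fine \o g).
Local Notation p := (fine \o Psi).

Lemma dom_fineK (k : 'rV[R]_n -> \bar R) x : k x != -oo%E -> dom k x -> (fine (k
  x))%:E = k x.
Proof. by move=> kx xk; rewrite fineK// fin_numElt ltNye kx. Qed.

Lemma dom_gE x : dom g x -> g x = (h x)%:E.
Proof. by move=> gx; rewrite /= dom_fineK//; case: hg. Qed.

Lemma prox_dom_gE x : S x -> g x = (h x)%:E.
Proof. by case=> /dom_gE. Qed.

Lemma prox_dom_PsiE x : S x -> Psi x = (p x)%:E.
Proof. by case=> _ Px; rewrite /= dom_fineK//; case: hPsi. Qed.

Lemma prox_dom_convex x y (t : R) : S x -> S y -> 0 <= t <= 1 ->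
  S (t *: x + (1 - t) *: y).
Proof.
move=> Sx Sy t01; split; rewrite /dom /=.
  case: hg => _ /(_ x y t t01) + _; rewrite (prox_dom_gE _ Sx) (prox_dom_gE _ Sy)
    => /le_lt_trans; apply.
  by rewrite -!EFinM -EFinD ltry.
case: hPsi => _ _ _ /(_ x y t (proj1 Sx) (proj1 Sy) t01) + _.
rewrite (prox_dom_PsiE _ Sx) (prox_dom_PsiE _ Sy) => /le_lt_trans; apply.
by rewrite -!EFinM; exact: ltry.
Qed.

Lemma prox_dom_convex_g x y (t : R) : S x -> S y -> 0 <= t <= 1 ->
  h (t *: x + (1 - t) *: y) <= t * h x + (1 - t) * h y.
Proof.
move=> Sx Sy t01; have Sxy := prox_dom_convex _ _ _ Sx Sy t01.
case: hg => _ /(_ x y t t01) + _.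
by rewrite !prox_dom_gE.
Qed.

Lemma prox_dom_convex_Psi x y (t : R) : S x -> S y -> 0 <= t <= 1 ->
  p (t *: x + (1 - t) *: y) <=
    t * p x + (1 - t) * p y - beta / 2 * t * (1 - t) * N (x - y) ^+ 2.
Proof.
move=> Sx Sy t01; have Sxy := prox_dom_convex _ _ _ Sx Sy t01.
case: hPsi => _ _ _ /(_ x y t (proj1 Sx) (proj1 Sy) t01) + _.
by rewrite !prox_dom_PsiE.
Qed.

Lemma prox_dom_ge0 x : S x -> 0 <= p x.
Proof.
move=> Sx; case: hPsi => _ /(_ x (proj1 Sx)) + _ _ _.
by rewrite prox_dom_PsiE// lee_fin.
Qed.

Lemma prox_objectiveE s (A c : R) x : S x ->
  prox_objective g Psi s A c x = (@regularized R n h p s A c x)%:E.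
Proof.
by move=> Sx; rewrite /prox_objective prox_dom_gE// prox_dom_PsiE.
Qed.

(** A point of [prox_dom] gives the objective a finite value, so its minimum is not +oo. Positive
    weights and the absence of -oo then force both [g v] and [Psi v] to be finite. *)
Lemma minimizer_argmin s (A c : R) v : S !=set0 -> 0 < A -> 0 < c ->
  minimizer (prox_objective g Psi s A c) v ->
  argmin_on S (@regularized R n h p s A c) v.
Proof.
move=> [x0 Sx0] A0 c0 vmin.
have vfin : (prox_objective g Psi s A c v < +oo)%E.
  by rewrite (le_lt_trans (vmin x0))// prox_objectiveE// ltry.
have Sv : S v.
  have gNy : g v != -oo%E by case: hg.
  have PNy : Psi v != -oo%E by case: hPsi.
  split; rewrite /dom /= ltNge leye_eq; apply/eqP => E; move: vfin;
    rewrite /prox_objective E gt0_muley ?lte_fin//.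
    rewrite addey// addye//; case: (Psi v) PNy => //= _.
    by rewrite gt0_muley.
  rewrite addey//; case: (g v) gNy => //= _.
  by rewrite gt0_muley.
split=> // y Sy; rewrite -lee_fin -!prox_objectiveE//.
Qed.

(** Solvability is given with weight 1 on [g]. The objective with data [(s, A, c)] is [A] times the
    one with data [(s / A, 1, c / A)]. *)
Lemma prox_argmin_exists s (A c : R) : S !=set0 -> 0 < A -> 0 < c ->
  exists v, argmin_on S (@regularized R n h p s A c) v.
Proof.
move=> S0 A0 c0; case: hPsi => _ _ _ _ /(_ (A^-1 *: s) (c / A) (divr_gt0 c0 A0)) [v].
move=> /(minimizer_argmin _ _ _ _ S0 ltr01 (divr_gt0 c0 A0)) [Sv vmin]; exists v;
  split => //.
have E y : @regularized R n h p s A c y = A * @regularized R n h p (A^-1 *: s) 1 (c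
  / A) y.
  by rewrite /regularized innerZl mul1r !mulrDr mulrA divff ?gt_eqF// mul1r mulrCA
    !mulrA divfK ?gt_eqF// (mulrC c).
by move=> y Sy; rewrite !E ler_wpM2l ?(ltW A0) ?vmin.
Qed.

End prox.

(** * Borel measurability in R^n *)

Section borel.
Context {R : realType} {n : nat}.
Local Notation V := (borel_rV R n).

Lemma open_measurable_rV (U : set 'rV[R]_n) : open U -> measurable (U : set V).
Proof. by move=> oU; exact: sub_sigma_algebra. Qed.

Lemma closed_measurable_rV (U : set 'rV[R]_n) : closed U -> measurable (U : set V).
Proof.
move=> cU; rewrite -[U]setCK; apply: measurableC.
by apply: open_measurable_rV; exact: closed_openC.
Qed.

Lemma continuous_measurable_rV {m} (f : 'rV[R]_n -> 'rV[R]_m) :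
  continuous f -> measurable_fun [set: V] (f : V -> borel_rV R m).
Proof.
move=> /continuousP cf; apply: (@measurability _ _ V (borel_rV R m) _ _ (@open
  'rV[R]_m)) => // _ [U oU <-].
by rewrite setTI; apply: open_measurable_rV; exact: cf.
Qed.

Lemma continuous_measurable_rV_real (f : 'rV[R]_n -> R) :
  continuous f -> measurable_fun [set: V] (f : V -> R).
Proof.
move=> /continuousP cf; apply: (measurability _ (RGenOInfty.measurableE R)) => _ [_
  [x ->] <-].
by rewrite setTI; apply: open_measurable_rV; apply: cf; exact: interval_open.
Qed.

(** Each sublevel set is the preimage of the closed epigraph under the continuous map [y -> (y, x)],
    hence closed. *)
Lemma lsc_measurable (f : 'rV[R]_n -> \bar R) :
  closed_fun f -> measurable_fun [set: V] (f : V -> \bar R).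
Proof.
move=> cf; apply: (measurability _ (ErealGenOInfty.measurableE R)) => _ [_ [x ->] <-].
rewrite setTI -[X in measurable X]setCK; apply: measurableC; apply:
  closed_measurable_rV.
have -> : ~` (f @^-1` `]x%:E, +oo[%classic) = (fun y => (y, x)) @^-1` [set p | (f
  p.1 <= p.2%:E)%E].
  apply/seteqP; split => y /=; rewrite in_itv/= andbT.
    by move/negP; rewrite -leNgt.
  by rewrite leNgt => /negP.
apply: (closed_comp _ cf) => y _.
have := @cvg_pair _ _ _ (nbhs y) (nbhs y) (nbhs x) _ _ _ id (cst x).
by apply; [exact: cvg_id|exact: cvg_cst].
Qed.

Context {d : measure_display} {T : measurableType d}.

Lemma measurable_coord (f : T -> 'rV[R]_n) i :
  measurable_fun setT (f : T -> V) -> measurable_fun setT (fun t => f t 0 i).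
Proof.
move=> mf; have mc : measurable_fun [set: V] (fun v : V => (v : 'rV[R]_n) 0 i).
  by apply: continuous_measurable_rV_real => v; exact: coord_continuous.
exact: (measurableT_comp mc mf).
Qed.

(* An open set is the union of the countably many balls with rational center and
   radius 1/(m+1) that it contains. *)
Lemma measurable_rowP (f : T -> 'rV[R]_n) :
  (forall i, measurable_fun setT (fun t => f t 0 i)) -> measurable_fun setT (f : T
    -> V).
Proof.
move=> mf; apply: (@measurability _ _ T V _ _ (@open 'rV[R]_n)) => // _ [U oU <-];
  rewrite setTI.
pose c (q : 'rV[rat]_n * nat) : 'rV[R]_n := \row_i ratr (q.1 0 i).
pose F (q : 'rV[rat]_n * nat) : set T := if `[< ball (c q) q.2.+1%:R^-1 `<=` U >]
  then \bigcap_(i in [set: 'I_n]) ((fun t => f t 0 i) @^-1` ball (c q 0 i)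
    q.2.+1%:R^-1) else set0.
have inball q t : ball (c q) q.2.+1%:R^-1 (f t) <->
    (\bigcap_(i in [set: 'I_n]) ((fun t => f t 0 i) @^-1` ball (c q 0 i)
      q.2.+1%:R^-1)) t.
  split; first by case=> _ + i _; exact.
  by move=> h; split; rewrite ?invr_gt0// => i j; rewrite (ord1 i); exact: h.
have -> : f @^-1` U = \bigcup_q F q.
  apply/seteqP; split => t /=.
    move=> Uft; have /nbhs_ballP[e /= e0 eU] := open_nbhs_nbhs (conj oU Uft).
    (* The radius is taken below [e / 2]: a ball of radius [r] whose center is within [r] of [f t]
       stays in the ball of radius [e] around [f t]. *)
    have [m em] := ltr_add_invr (divr_gt0 e0 (ltr0n _ 2)).
    rewrite add0r in em.
    have m0 : 0 < m.+1%:R^-1 :> R by rewrite invr_gt0.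
    set r := m.+1%:R^-1 in em m0.
    have qex i : exists q : rat, `|ratr q - f t 0 i| < r.
      have /rat_in_itvoo[q] : f t 0 i - r < f t 0 i + r by lra.
      by rewrite in_itv /= => /andP[q1 q2]; exists q; rewrite ltr_norml; lra.
    have [q hq] := choice qex.
    exists (\row_i q i, m) => //; rewrite /F /= -/r ifT; last first.
      apply/asboolP => y [/= _ hy]; apply: eU; split => // i j.
      have := hy i j; rewrite (ord1 i) /ball /= mxE mxE.
      have := hq j; rewrite !ltr_norml; lra.
    by move=> i _; rewrite /ball /= mxE mxE.
  case=> q _; rewrite /F; case: asboolP => // qU /inball; exact: qU.
apply: countable_bigcupT_measurable => [|q]; first exact: countableP.
rewrite /F; case: ifP => // _; apply: fin_bigcap_measurable => // i _.
by rewrite -[X in measurable X]setTI; apply: mf => //; exact: measurable_ball.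
Qed.

Lemma measurable_rowD (f1 f2 : T -> 'rV[R]_n) :
  measurable_fun setT (f1 : T -> V) -> measurable_fun setT (f2 : T -> V) ->
  measurable_fun setT ((fun t => f1 t + f2 t) : T -> V).
Proof.
move=> m1 m2; apply: measurable_rowP => i; under eq_fun do rewrite mxE.
by apply: measurable_funD; exact: measurable_coord.
Qed.

Lemma measurable_rowZ (a : R) (f : T -> 'rV[R]_n) :
  measurable_fun setT (f : T -> V) -> measurable_fun setT ((fun t => a *: f t) : T
    -> V).
Proof.
move=> mf; apply: measurable_rowP => i; under eq_fun do rewrite mxE.
by apply: measurable_funM => //; exact: measurable_coord.
Qed.

Lemma measurable_inner (f1 f2 : T -> 'rV[R]_n) :
  measurable_fun setT (f1 : T -> V) -> measurable_fun setT (f2 : T -> V) ->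
  measurable_fun setT (fun t => inner (f1 t) (f2 t)).
Proof.
move=> m1 m2; apply: measurable_sum => i.
by apply: measurable_funM; exact: measurable_coord.
Qed.

End borel.

(** * Independence of the next sample from the past *)

Section independence.
Context {R : realType} {d d' d'' : measure_display}.
Context {Xi : measurableType d} {Omega : measurableType d'} {T : measurableType d''}.
Context {P : probability Omega R} {D : probability Xi R}.
Context {Y : Omega -> T} {X : Omega -> Xi}.
Hypotheses (mY : measurable_fun setT Y) (mX : measurable_fun setT X).
Hypothesis indep : forall A B, measurable A -> measurable B ->
  P (Y @^-1` A `&` X @^-1` B) = (P (Y @^-1` A) * D B)%E.

Let mYX : measurable_fun setT (fun o => (Y o, X o)).
Proof. exact: measurable_fun_pair. Qed.

Let rvY : {RV P >-> T} := HB.pack Y (isMeasurableFun.Build _ _ _ _ _ mY).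
Let rvYX : {RV P >-> (T * Xi)%type} :=
  HB.pack (fun o => (Y o, X o)) (isMeasurableFun.Build _ _ _ _ _ mYX).

(** By independence the law of [(Y, X)] agrees with the product of the law of [Y] and [D] on
    rectangles, hence everywhere; Tonelli's theorem gives the iterated integral. *)
Lemma ge0_integral_indep (phi : T * Xi -> \bar R) :
  measurable_fun setT phi -> (forall p, (0 <= phi p)%E) ->
  (\int[P]_o phi (Y o, X o) = \int[P]_o \int[D]_z phi (Y o, z))%E.
Proof.
move=> mphi phi0.
have := ge0_integral_pushforward mYX P measurableT mphi (fun p _ => phi0 p).
rewrite preimage_setT => <-.
have E (A : set (T * Xi)) : measurable A ->
    (distribution P rvY \x D)%E A = distribution P rvYX A.
  apply: product_measure_unique => A1 A2 mA1 mA2; rewrite -indep//.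
transitivity (\int[distribution P rvY \x D]_p phi p)%E.
  apply: eq_measure_integral => A mA _; exact: (esym (E A mA)).
rewrite fubini_tonelli1//.
rewrite ge0_integral_pushforward//; last first.
  by move=> y _; exact: integral_ge0.
exact: measurable_fun_fubini_tonelli_F.
Qed.

Lemma measurable_integral_indep (phi : T * Xi -> \bar R) :
  measurable_fun setT phi -> (forall p, (0 <= phi p)%E) ->
  measurable_fun setT (fun o => \int[D]_z phi (Y o, z))%E.
Proof.
move=> mphi phi0; have := @measurable_fun_fubini_tonelli_F _ _ _ _ _ D phi mphi phi0.
by move=> /measurableT_comp; apply.
Qed.

Let integrable_indep_ge0 (phi : T * Xi -> \bar R) :
  measurable_fun setT phi -> (forall p, (0 <= phi p)%E) ->
  P.-integrable setT (fun o => phi (Y o, X o)) ->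
  P.-integrable setT (fun o => \int[D]_z phi (Y o, z))%E.
Proof.
move=> mphi phi0 /integrableP[_ iphi]; apply/integrableP; split.
  exact: measurable_integral_indep.
rewrite (eq_integral (fun o => \int[D]_z phi (Y o, z))%E); last first.
  by move=> o _; rewrite gee0_abs// integral_ge0.
rewrite -ge0_integral_indep//.
by rewrite (eq_integral (fun o => `|phi (Y o, X o)|)%E)// => o _; rewrite gee0_abs.
Qed.

(** The nonnegative case is applied to the positive and negative parts, whose inner integrals are
    both integrable, so their difference may be integrated termwise. *)
Lemma integral_indep (phi : T * Xi -> \bar R) :
  measurable_fun setT phi ->
  P.-integrable setT (fun o => phi (Y o, X o)) ->
  P.-integrable setT (fun o => \int[D]_z phi (Y o, z))%E /\
  (\int[P]_o phi (Y o, X o) = \int[P]_o \int[D]_z phi (Y o, z))%E.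
Proof.
move=> mphi iphi.
have mp := measurable_funepos mphi; have mn := measurable_funeneg mphi.
have ip : P.-integrable setT (fun o => \int[D]_z phi^\+ (Y o, z))%E.
  apply: integrable_indep_ge0 => //.
  by have := integrable_funepos measurableT iphi; rewrite (funepos_comp phi (fun o
    => (Y o, X o))).
have im : P.-integrable setT (fun o => \int[D]_z phi^\- (Y o, z))%E.
  apply: integrable_indep_ge0 => //.
  by have := integrable_funeneg measurableT iphi; rewrite (funeneg_comp phi (fun o
    => (Y o, X o))).
have E : (fun o => \int[D]_z phi (Y o, z))%E =
   (fun o => \int[D]_z phi^\+ (Y o, z) - \int[D]_z phi^\- (Y o, z))%E.
  apply/funext => o; rewrite [LHS]integralE.
  by rewrite (funepos_comp phi (fun z => (Y o, z))) (funeneg_comp phi (fun z => (Y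
    o, z))).
rewrite E; split; first exact: integrableB.
rewrite integralB// -!ge0_integral_indep// [LHS]integralE.
by rewrite (funepos_comp phi (fun o => (Y o, X o))) (funeneg_comp phi (fun o => (Y
  o, X o))).
Qed.

End independence.

(** * Sigma-algebras generated by the past samples *)

Section past.
Context {R : realType} {d d' : measure_display}.
Context {Xi : measurableType d} {Omega : measurableType d'}.
Context {P : probability Omega R} {D : probability Xi R} {xi : nat -> {RV P >-> Xi}}.

(* [past l] is Omega with the sigma-algebra generated by the samples 0, ..., l-1. *)
Definition past_cylinders (l : nat) : set (set Omega) :=
  [set A | exists2 B : nat -> set Xi, (forall j, measurable (B j)) &
     A = \bigcap_(j in [set j | (j < l)%N]) (xi j @^-1` B j)].

Definition past l := g_sigma_algebraType (past_cylinders l).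

Let sample_measurable j (B : set Xi) : measurable B -> measurable (xi j @^-1` B).
Proof. by move=> mB; rewrite -[X in measurable X]setTI; exact: measurable_funP. Qed.

Lemma past_cylinders_measurable l : past_cylinders l `<=` measurable.
Proof.
move=> _ [B mB ->]; rewrite bigcap_mkord.
by apply: bigsetI_measurable => j _; exact: sample_measurable.
Qed.

Lemma past_measurable l (A : set Omega) : measurable (A : set (past l)) ->
  measurable A.
Proof.
apply: smallest_sub; first exact: sigma_algebra_measurable.
exact: past_cylinders_measurable.
Qed.

Lemma past_measurable_fun d1 (T : measurableType d1) l (Y : Omega -> T) :
  measurable_fun setT (Y : past l -> T) -> measurable_fun setT Y.
Proof. by move=> mY _ B mB; apply: (past_measurable l); exact: mY. Qed.

Lemma past_cylindersT l : past_cylinders l setT.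
Proof. by exists (fun=> setT) => //; apply/seteqP; split=> //. Qed.

Lemma past_sample l : measurable_fun setT (xi l : past l.+1 -> Xi).
Proof.
move=> _ B mB; rewrite setTI; apply: sub_sigma_algebra.
exists (fun j => if j == l then B else setT) => [j|]; first by case: ifP.
apply/seteqP; split => [t Bt j /= _|o Bo]; first by case: eqVneq => [->|].
by have := Bo l (ltnSn l); rewrite /= eqxx.
Qed.

Lemma past_subset l (A : set Omega) :
  measurable (A : set (past l)) -> measurable (A : set (past l.+1)).
Proof.
apply: smallest_sub; first exact: sigma_algebra_measurable.
move=> _ [B mB ->]; apply: sub_sigma_algebra.
exists (fun j => if (j < l)%N then B j else setT) => [j|]; first by case: ifP.
apply/seteqP; split => o Bo j /= jl.
  by case: ifP => // ?; exact: Bo.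
by have := Bo j (ltnW jl); rewrite /= jl.
Qed.

Lemma past_funS d1 (T : measurableType d1) l (Y : Omega -> T) :
  measurable_fun setT (Y : past l -> T) -> measurable_fun setT (Y : past l.+1 -> T).
Proof. by move=> mY _ B mB; apply: past_subset; exact: mY. Qed.

Hypothesis hxi : iid_samples D xi.

(** Both sides are finite measures in [A]. They agree on the cylinders, which are closed under
    intersection and generate [past l], so they agree on all of it. *)
Lemma past_indep l (A : set Omega) (B : set Xi) :
  measurable (A : set (past l)) -> measurable B ->
  P (A `&` xi l @^-1` B) = (P A * D B)%E.
Proof.
move=> mA mB; have mxB := sample_measurable l _ mB.
have DB0 : 0 <= fine (D B) by rewrite fine_ge0.
have DBE : ((fine (D B))%:E = D B)%E by rewrite fineK// fin_num_measure.
pose m2 := mscale (NngNum DB0) P.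
have m2E C : m2 C = (P C * D B)%E by rewrite /m2 /= /mscale /= DBE muleC.
transitivity (mrestr P mxB A) => //; transitivity (m2 A); last first.
  exact: m2E.
apply: (g_sigma_algebra_measure_unique (past_cylinders l) _ (fun=> setT)) mA.
- exact: past_cylinders_measurable.
- move=> _; exact: past_cylindersT.
- exact: bigcup_const.
- move=> _ _ [B1 mB1 ->] [B2 mB2 ->]; exists (fun j => B1 j `&` B2 j).
    by move=> j; exact: measurableI.
  by rewrite -bigcapI.
- move=> _ [C mC ->]; apply: etrans (esym (m2E _)); rewrite /= /mrestr.
  case: hxi => same prodr.
  (* Appending [B] at index l turns the intersection into a cylinder over l + 1 samples, to which
     the product formula applies. *)
  pose C' j := if (j < l)%N then C j else B.
  have mC' j : measurable (C' j) by rewrite /C'; case: ifP.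
  have := prodr (iota 0 l.+1) C' (iota_uniq _ _) (fun j _ => mC' j).
  have := prodr (iota 0 l) C (iota_uniq _ _) (fun j _ => mC j).
  have iotaE k : [set` iota 0 k] = [set j | (j < k)%N].
    by apply/seteqP; split => j /=; rewrite mem_iota.
  rewrite !iotaE => PC; rewrite -[l.+1]addn1 iotaD big_cat big_seq1 /= add0n.
  have -> : (\prod_(j <- iota 0 l) P (xi j @^-1` C' j) = \prod_(j <- iota 0 l) P
    (xi j @^-1` C j))%E.
    by apply: eq_big_seq => j; rewrite mem_iota /C' => /andP[_ ->].
  rewrite -PC {2}/C' ltnn addn1.
  have -> : P (xi l @^-1` B) = D B by exact: same.
  move=> <-; congr (P _); apply/seteqP; split => o.
    move=> [Co Bo] j /=; rewrite ltnS leq_eqVlt /C' => /predU1P[->|jl].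
      by rewrite ltnn.
    by rewrite jl; exact: Co.
  move=> Co; split; last by have := Co l (ltnSn l); rewrite /C' /= ltnn.
  by move=> j /= jl; have := Co j (ltnW jl); rewrite /C' /= jl.
- by move=> k; rewrite /= /mrestr /= setTI; rewrite (le_lt_trans (probability_le1 _
  _))// ltry.
Qed.

End past.

(** * Convergence in expectation *)

Section square_integrable.
Context {R : realType} {d : measure_display} {T : measurableType d}.
Context {P : probability T R}.
Implicit Types f a b : T -> R.

Lemma integrable_le f a : measurable_fun setT f -> (forall t, `|f t| <= a t) ->
  P.-integrable setT (EFin \o a) -> P.-integrable setT (EFin \o f).
Proof.
move=> mf fa; apply: le_integrable => //; first exact/measurable_EFinP.
by move=> t _ /=; rewrite lee_fin (le_trans (fa t))// ler_norm.
Qed.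

Definition square_integrable f :=
  measurable_fun setT f /\ P.-integrable setT (EFin \o (fun t => f t ^+ 2)).

Lemma square_integrable_cst (r : R) : square_integrable (cst r).
Proof. by split => //; exact: (finite_measure_integrable_cst P (r ^+ 2)
  measurableT). Qed.

Lemma square_integrable_le f a b : measurable_fun setT f ->
  (forall t, `|f t| <= a t + b t) ->
  square_integrable a -> square_integrable b -> square_integrable f.
Proof.
move=> mf fab [ma ia] [mb ib]; split => //.
apply: (@integrable_le _ (fun t => 2 * (a t ^+ 2) + 2 * (b t ^+ 2))).
- exact: measurable_funX.
- move=> t; rewrite normrX; apply: (@le_trans _ _ ((a t + b t) ^+ 2)).
    by rewrite ler_sqr ?nnegrE// (le_trans _ (fab t)).
  have := sqr_ge0 (a t - b t); lra.
- have := integrableD measurableT (integrableZl measurableT 2 ia) (integrableZl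
  measurableT 2 ib).
  by apply: eq_integrable => // t _ /=.
Qed.

(** The product is dominated by [a^2 + b^2]. *)
Lemma integrable_mul_le f a b : measurable_fun setT f ->
  (forall t, `|f t| <= a t * b t) ->
  square_integrable a -> square_integrable b -> P.-integrable setT (EFin \o f).
Proof.
move=> mf fab [ma ia] [mb ib].
apply: (@integrable_le _ (fun t => a t ^+ 2 + b t ^+ 2)) => //.
  by move=> t; apply: (le_trans (fab t)); have := sqr_ge0 (a t - b t); have :=
    sqr_ge0 (a t + b t); lra.
by have := integrableD measurableT ia ib; apply: eq_integrable => // t _ /=.
Qed.

Lemma integrable_sumr I (s : seq I) (F : I -> T -> R) :
  (forall i, P.-integrable setT (EFin \o F i)) ->
  P.-integrable setT (EFin \o (fun t => \sum_(i <- s) F i t)).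
Proof.
move=> iF; have := @integrable_sum _ _ _ P _ measurableT _ s xpredT _ (fun i _ =>
  iF i).
by apply: eq_integrable => // t _ /=; rewrite sumEFin.
Qed.

Lemma Rintegral_sum I (s : seq I) (F : I -> T -> R) :
  (forall i, P.-integrable setT (EFin \o F i)) ->
  \int[P]_t (\sum_(i <- s) F i t) = \sum_(i <- s) \int[P]_t F i t.
Proof.
move=> iF; elim: s => [|i s IH].
  by under eq_Rintegral do rewrite big_nil; rewrite big_nil Rintegral_cst// mul0r.
under eq_Rintegral do rewrite big_cons.
by rewrite big_cons -IH RintegralD//; exact: integrable_sumr.
Qed.

End square_integrable.

(** The sum is compared with a telescoping one: with [a = sqrt k] and [b = sqrt (k+1)], the relation
    [b^2 = a^2 + 1] gives [2 b (b - a) - 1 = (b - a)^2 >= 0]. *)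
Lemma sum_inv_sqrt_le (R : rcfType) k :
  \sum_(l < k) (2 * Num.sqrt l.+1%:R)^-1 <= Num.sqrt k%:R :> R.
Proof.
elim: k => [|k IH]; first by rewrite big_ord0 sqrtr0.
rewrite big_ord_recr /=; apply: le_trans (lerD IH (lexx _)) _.
set a := Num.sqrt k%:R; set b := Num.sqrt k.+1%:R.
have b0 : 0 < b by rewrite sqrtr_gt0.
have a2 : a ^+ 2 = k%:R by rewrite sqr_sqrtr.
have b2 : b ^+ 2 = a ^+ 2 + 1 by rewrite a2 sqr_sqrtr// -natr1.
rewrite -lerBrDl -div1r ler_pdivrMr ?mulr_gt0//.
have := sqr_ge0 (b - a); nra.
Qed.

(** * The stochastic method along its sample paths *)

Section convergence.
Context {R : realType} {n : nat} {d d' : measure_display}.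
Context {Xi : measurableType d} {Omega : measurableType d'}.
Context {D : probability Xi R} {P : probability Omega R} {N : 'rV[R]_n -> R}.
Context {f : 'rV[R]_n -> Xi -> \bar R} {g Psi : 'rV[R]_n -> \bar R} {beta G : R}.
Context {w : 'rV[R]_n -> Xi -> 'rV[R]_n} {xi : nat -> {RV P >-> Xi}}.
Context {x : nat -> Omega -> 'rV[R]_n} {xstar : 'rV[R]_n}.
Hypothesis hN : is_norm N.
Hypothesis hfbar : closed_convex (expected_fun D f).
Hypothesis hg : closed_convex g.
Hypothesis hdomg : closed (dom g).
Hypothesis hw : subgradient_oracle D (expected_fun D f) g w.
Hypothesis hPsi : prox_function N g beta Psi.
Hypothesis hxi : iid_samples D xi.
Hypothesis hx : forall omega, RQM (fun _ => 1) (fun k => Num.sqrt k.+1%:R) g Psi w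
  (fun k => xi k omega) (fun k => x k omega).
Hypothesis hxstar_dom : dom g xstar.
Hypothesis hxstar_Psi : dom Psi xstar.
Hypothesis hxstar : minimizer (composite D f g) xstar.
Hypothesis hwG : forall y, dom (expected_fun D f) y ->
  ('E_D[fun z => (dual_norm N (w y z) ^+ 2)%R] <= (G ^+ 2)%:E)%E.

Local Notation V := (borel_rV R n).
Local Notation S := (@prox_dom R n g Psi).
Local Notation h := (fine \o g).
Local Notation p := (fine \o Psi).
Local Notation fbar := (expected_fun D f).
Local Notation phi := (fine \o fbar).
Local Notation gam l := (Num.sqrt l.+1%:R).
Local Notation reg := (@regularized R n h p).

Let W l o := w (x l o) (xi l o).
Let s l o := \sum_(j < l) W j o.
(* The point v_l is recovered from the iterates; it is x_(l-1)^+ when l > 0. *)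
Let v l o := if l is j.+1 then j.+2%:R *: x j.+1 o - j.+1%:R *: x j o else x 0%N o.

Let S0 : S !=set0. Proof. by exists xstar; split. Qed.

Let gam_gt0 l : 0 < gam l :> R. Proof. by rewrite sqrtr_gt0. Qed.

Let beta_gt0 : 0 < beta. Proof. by case: hPsi. Qed.

Let weight_sum1 k : weight_sum (fun _ => 1) k = k.+1%:R :> R.
Proof. by rewrite /weight_sum sumr_const card_ord. Qed.

Let v_step l o : x l.+1 o = (l.+1%:R / l.+2%:R) *: x l o + (1 / l.+2%:R) *: v l.+1 o.
Proof.
rewrite /v scalerBr !scalerA mul1r mulVf ?pnatr_eq0// scale1r (mulrC _^-1).
by rewrite addrCA subrr addr0.
Qed.

(** [RQM] provides its sequences outcome by outcome through an existential. They are identified here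
    with the explicit functions [s] and [v], both shifted by one index: [s l.+1] is s_l and [v l.+1]
    is x_l^+. *)
Let v_argmin l o : argmin_on S (reg (s l o) l.+1%:R (gam l)) (v l o).
Proof.
case: (hx o) => t [xp [x0 tS xpmin xS]].
have sE k : s k.+1 o = t k.
  by elim: k => [|k IH]; rewrite tS /s big_ord_recr /= ?big_ord0 -?/(s _ _) ?IH
    scale1r.
case: l => [|l].
  rewrite /s big_ord0; apply: (minimizer_argmin hg hPsi) => //.
  by move: x0; rewrite weight_sum1.
have -> : v l.+1 o = xp l.
  rewrite /v xS !weight_sum1 scalerDr !scalerA mulrCA divff ?pnatr_eq0// mulr1.
  by rewrite mulrC divfK ?pnatr_eq0// scale1r addrAC subrr add0r.
rewrite sE; apply: (minimizer_argmin hg hPsi) => //.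
by have := xpmin l; rewrite weight_sum1.
Qed.

Let v_in l o : S (v l o). Proof. by case: (v_argmin l o). Qed.

Let x_in l o : S (x l o).
Proof.
exact: (averaged_iterate_in (@prox_dom_convex _ _ _ _ _ _ hg hPsi)
  (fun l => x l o) (fun l => v l o) erefl (fun l => v_step l o) (fun l => v_in l o)).
Qed.

(* The oracle is only measurable on dom g, where all iterates live. *)
Let wext : V * Xi -> V :=
  (fun p : V * Xi => w p.1 p.2 : V) \_ (dom g `*` [set: Xi]).

Let wextE y z : dom g y -> wext (y, z) = w y z.
Proof.
move=> gy; rewrite /wext /patch ifT//; apply/mem_set; split; first exact: gy.
by [].
Qed.

Let wext_measurable : measurable_fun setT wext.
Proof.
have mg : measurable (dom g `*` [set: Xi] : set (V * Xi)).
  by apply: measurableX => //; exact: closed_measurable_rV.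
by apply: (proj1 (measurable_restrictT _ mg)); case: hw.
Qed.

(** * Measurability of the iterates with respect to the past *)

Local Notation past := (@past R d d' Xi Omega P xi).

(** Uniqueness of minimizers writes [v l] as [U \o s l] for one fixed choice [U] of solutions, and
    [U] is continuous. *)
Let v_adapted l : measurable_fun setT (s l : past l -> V) ->
  measurable_fun setT (v l : past l -> V).
Proof.
move=> ms.
have [U mU] := choice (fun t => prox_argmin_exists hg hPsi t _ _ S0 (ltr0Sn R l)
  (gam_gt0 l)).
have -> : v l = U \o s l.
  apply/funext => o; apply: (argmin_unique hN _ _ _ beta_gt0 _ _ _ _ _ _ _
    (v_argmin l o) (mU _)) => //.
  - exact: prox_dom_convex hg hPsi.
  - exact: prox_dom_convex_g hg hPsi.
  - exact: prox_dom_convex_Psi hg hPsi.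
have cU : continuous U.
  apply: (argmin_continuous hN _ _ _ beta_gt0 _ _ _ _ _ mU) => //.
  - exact: prox_dom_convex hg hPsi.
  - exact: prox_dom_convex_g hg hPsi.
  - exact: prox_dom_convex_Psi hg hPsi.
exact: (measurableT_comp (continuous_measurable_rV _ cU) ms).
Qed.

Let W_adapted l : measurable_fun setT (x l : past l -> V) ->
  measurable_fun setT (W l : past l.+1 -> V).
Proof.
move=> mx; have -> : W l = wext \o (fun o => (x l o, xi l o)).
  by apply/funext => o; rewrite /= wextE//; case: (x_in l o).
apply: (@measurableT_comp _ _ _ (past l.+1) (V * Xi)%type V) => //.
by apply: measurable_fun_pair; [exact: past_funS|exact: past_sample].
Qed.

(** The two claims need a joint induction: the next [s] requires the subgradient at the current [x],
    and the next [x] requires the minimizer determined by the next [s]. *)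
Let sx_adapted l : measurable_fun setT (s l : past l -> V) /\
  measurable_fun setT (x l : past l -> V).
Proof.
elim: l => [|l [ms mx]].
  have ms : measurable_fun setT (s 0 : past 0 -> V).
    by rewrite /s; under eq_fun do rewrite big_ord0; exact: measurable_cst.
  by split => //; exact: v_adapted.
have msS : measurable_fun setT (s l.+1 : past l.+1 -> V).
  rewrite /s; under eq_fun do rewrite big_ord_recr /=.
  by apply: measurable_rowD; [exact: past_funS|exact: W_adapted].
split => //.
rewrite (_ : x l.+1 = fun o => (l.+1%:R / l.+2%:R) *: x l o + (1 / l.+2%:R) *: v
  l.+1 o).
  apply: measurable_rowD; apply: measurable_rowZ; first exact: past_funS.
  exact: v_adapted.
by apply/funext => o; exact: v_step.
Qed.

Let x_adapted l : measurable_fun setT (x l : past l -> V) := proj2 (sx_adapted l).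
Let u_adapted l : measurable_fun setT ((fun o => v l o - xstar) : past l -> V).
Proof.
apply: measurable_rowD; last exact: measurable_cst.
by apply: v_adapted; case: (sx_adapted l).
Qed.

(** * Second moments and conditional means *)

Let dual_measurable : measurable_fun setT (dual_norm N : V -> R).
Proof. by apply: continuous_measurable_rV_real; exact: dual_norm_continuous hN. Qed.

Let norm_measurable : measurable_fun setT (N : V -> R).
Proof. by apply: continuous_measurable_rV_real; exact: is_norm_continuous hN. Qed.

Let W_dual_measurable l : measurable_fun setT (fun o => dual_norm N (W l o)).
Proof.
have mW := past_measurable_fun _ _ _ _ (W_adapted _ (x_adapted l)).
exact: (measurableT_comp dual_measurable mW).
Qed.

Let past_indep_pair d1 (T : measurableType d1) (Y : Omega -> T) l :
  measurable_fun setT (Y : past l -> T) ->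
  forall A B, measurable A -> measurable B ->
    P (Y @^-1` A `&` xi l @^-1` B) = (P (Y @^-1` A) * D B)%E.
Proof.
move=> mY A B mA mB; apply: (past_indep hxi) => //.
by rewrite -[X in measurable X]setTI; exact: mY.
Qed.

(** A subgradient exists at every point of [dom g], and [subdifferential] includes finiteness of the
    function at the point. *)
Let fbar_dom y : dom g y -> dom fbar y.
Proof. by case: hw => _ + gy => /(_ y gy)[_ _ []]. Qed.

(** Integrate over the sample [xi l] first, with [x l] frozen by independence; the second-moment
    bound then applies at each value of [x l]. *)
Let W_dual_bound l : (\int[P]_o (dual_norm N (W l o) ^+ 2)%:E <= (G ^+ 2)%:E)%E.
Proof.
pose F (q : V * Xi) : \bar R := (dual_norm N (wext q) ^+ 2)%:E.
have mF : measurable_fun setT F.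
  apply/measurable_EFinP/measurable_funX.
  exact: (measurableT_comp dual_measurable wext_measurable).
have F0 q : (0 <= F q)%E by rewrite lee_fin sqr_ge0.
have mx := past_measurable_fun _ _ _ _ (x_adapted l).
rewrite (eq_integral (fun o => F (x l o, xi l o))); last first.
  by move=> o _; rewrite /F wextE//; case: (x_in l o).
rewrite (ge0_integral_indep mx (measurable_funP (xi l)) (past_indep_pair _ _ _ _
  (x_adapted l)))//.
apply: (@le_trans _ _ (\int[P]_o (cst (G ^+ 2)%:E o))%E); last first.
  by rewrite integral_cst//= probability_setT mule1.
apply: ge0_le_integral => //.
- by move=> o _; exact: integral_ge0.
- exact: (measurable_integral_indep mx).
- move=> o _; have [gx _] := x_in l o; apply: le_trans (hwG _ (fbar_dom _ gx)).
  rewrite unlock le_eqVlt; apply/orP; left; apply/eqP.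
  by apply: eq_integral => z _; rewrite /F wextE.
Qed.

Let W_square_integrable l : square_integrable (P := P) (fun o => dual_norm N (W l o)).
Proof.
split; first exact: W_dual_measurable.
apply/integrableP; split; first exact/measurable_EFinP/measurable_funX.
apply: le_lt_trans (ltry (G ^+ 2)); apply: le_trans (W_dual_bound l).
rewrite le_eqVlt; apply/orP; left; apply/eqP.
by apply: eq_integral => o _; rewrite /= ger0_norm// sqr_ge0.
Qed.

Let s_square_integrable l : square_integrable (P := P) (fun o => dual_norm N (s l o)).
Proof.
elim: l => [|l IH].
  rewrite (_ : (fun o => _) = cst 0); first exact: square_integrable_cst.
  by apply/funext => o; rewrite /s big_ord0 (dual_norm0 hN).
apply: square_integrable_le IH (W_square_integrable l).
  have ms := past_measurable_fun _ _ _ _ (proj1 (sx_adapted l.+1)).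
  exact: (measurableT_comp dual_measurable ms).
move=> o; rewrite ger0_norm ?(dual_norm_ge0 hN)// /s big_ord_recr /=.
exact: dual_norm_triangle hN _ _.
Qed.

(** The domain may be unbounded, so the bound comes from the Lipschitz estimate: the distance from
    [v l] to the minimizer [v0] for zero linear term is at most the dual norm of [s l] over
    [gam l * beta]. *)
Let u_square_integrable l : square_integrable (P := P) (fun o => N (v l o - xstar)).
Proof.
have [v0 mv0] := prox_argmin_exists hg hPsi 0 _ _ S0 (ltr0Sn R l) (gam_gt0 l).
have cb : 0 < gam l * beta by rewrite mulr_gt0.
apply: (@square_integrable_le _ _ _ _ _ (fun o => (gam l * beta)^-1 * dual_norm N
  (s l o))
    (cst (N (v0 - xstar)))).
- have mu := past_measurable_fun _ _ _ _ (u_adapted l).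
  exact: (measurableT_comp norm_measurable mu).
- move=> o; rewrite ger0_norm ?(is_norm_ge0 hN)//.
  rewrite (_ : v l o - xstar = (v l o - v0) + (v0 - xstar)); last by rewrite addrA
    subrK.
  case: (hN) => ND _ _; apply: (le_trans (ND _ _)); rewrite lerD2r ler_pdivlMl//.
  rewrite -[s l o]subr0; apply: (argmin_lip hN _ _ _ beta_gt0 _ _ _ _ _ _ _ _
    (v_argmin l o) mv0) => //.
  + exact: prox_dom_convex hg hPsi.
  + exact: prox_dom_convex_g hg hPsi.
  + exact: prox_dom_convex_Psi hg hPsi.
- case: (s_square_integrable l) => ms is_; split; first exact: measurable_funM.
  have := integrableZl measurableT ((gam l * beta)^-1 ^+ 2) is_.
  by apply: eq_integrable => // o _ /=; rewrite exprMn.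
- exact: square_integrable_cst.
Qed.

Let m l o : 'rV[R]_n := mean D (w (x l o)).

Let W_inner_integrable l : P.-integrable setT (EFin \o (fun o => inner (W l o) (v l
  o - xstar))).
Proof.
apply: (integrable_mul_le _ (fun o => dual_norm N (W l o)) (fun o => N (v l o -
  xstar))) => //.
- have mW := past_measurable_fun _ _ _ _ (W_adapted _ (x_adapted l)).
  exact: (measurable_inner _ _ mW (past_measurable_fun _ _ _ _ (u_adapted l))).
- by move=> o; exact: dual_norm_abs hN _ _.
Qed.

Let inner_mean y t : dom g y ->
  (\int[D]_z (inner (w y z) t)%:E = (inner (mean D (w y)) t)%:E)%E.
Proof.
move=> gy; case: hw => _ /(_ y gy)[wL _ _].
have wi i : D.-integrable setT (EFin \o (fun z => w y z 0 i)) by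
  exact/Lfun1_integrable.
have Ei i : D.-integrable setT (fun z => (w y z 0 i * t 0 i)%:E).
  have := integrableZr measurableT (t 0 i) (wi i).
  by apply: eq_integrable.
rewrite /inner; under eq_integral do rewrite -sumEFin.
rewrite integral_sum// -sumEFin; apply: eq_bigr => i _; rewrite mxE unlock.
under eq_integral do rewrite EFinM.
rewrite integralZr//; last exact: wi.
by rewrite [RHS]EFinM fineK// integrable_fin_num//; exact: wi.
Qed.

(** The pair [Y] of [x l] and [v l - xstar] depends on the past only. Freezing it and integrating
    over [xi l] replaces the oracle's answer by its mean, since [inner] is linear. *)
Let mean_inner l :
  P.-integrable setT (EFin \o (fun o => inner (m l o) (v l o - xstar))) /\
  \int[P]_o inner (m l o) (v l o - xstar) = \int[P]_o inner (W l o) (v l o - xstar).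
Proof.
pose Y o : V * V := (x l o, v l o - xstar).
have aY : measurable_fun setT (Y : past l -> (V * V)%type).
  by apply: measurable_fun_pair.
have mY := past_measurable_fun _ _ _ _ aY.
pose F (q : (V * V) * Xi) : \bar R := (inner (wext (q.1.1, q.2)) q.1.2)%:E.
have mF : measurable_fun setT F.
  have mpair : measurable_fun setT (fun q : (V * V) * Xi => (q.1.1, q.2)).
    apply: measurable_fun_pair => //.
    exact: (measurableT_comp measurable_fst measurable_fst).
  have mw := measurableT_comp wext_measurable mpair.
  apply/measurable_EFinP; apply: (measurable_inner _ _ mw).
  exact: (measurableT_comp measurable_snd measurable_fst).
have FW o : F (Y o, xi l o) = (inner (W l o) (v l o - xstar))%:E.
  by rewrite /F wextE//; case: (x_in l o).
have Fm o : (\int[D]_z F (Y o, z) = (inner (m l o) (v l o - xstar))%:E)%E.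
  have [gx _] := x_in l o; rewrite -inner_mean//.
  by apply: eq_integral => z _; rewrite /F wextE.
have iF : P.-integrable setT (fun o => F (Y o, xi l o)).
  by have := W_inner_integrable l; apply: eq_integrable => // o _; rewrite FW.
have [i1 i2] := integral_indep mY (measurable_funP (xi l)) (past_indep_pair _ _ _ _
  aY) F mF iF.
split; first by move: i1; apply: eq_integrable => // o _; rewrite Fm.
congr fine; transitivity (\int[P]_o \int[D]_z F (Y o, z))%E.
  by apply: eq_integral => o _; rewrite Fm.
by rewrite -i2; apply: eq_integral => o _; rewrite FW.
Qed.

(** * Pathwise gap bound and its expectation *)

Let fbarE y : dom g y -> fbar y = (phi y)%:E.
Proof. by move=> /fbar_dom gy; rewrite /= dom_fineK//; case: hfbar. Qed.

Let mean_subgradient l o y : S y ->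
  phi (x l o) + inner (m l o) (y - x l o) <= phi y.
Proof.
move=> [gy _]; have [gx _] := x_in l o.
case: hw => _ /(_ _ gx)[_ _ [_ /(_ y)]].
by rewrite (fbarE _ gx) (fbarE _ gy) -EFinD lee_fin.
Qed.

Let compositeE y : dom g y -> composite D f g y = (phi y + h y)%:E.
Proof. by move=> gy; rewrite /composite fbarE// (dom_gE hg). Qed.

Let Fr k o : R := phi (x k o) + h (x k o).
Let Fstar : R := phi xstar + h xstar.

Let Fr_measurable k : measurable_fun setT (Fr k).
Proof.
have mx := past_measurable_fun _ _ _ _ (x_adapted k).
have mfine (q : 'rV[R]_n -> \bar R) : closed_fun q -> measurable_fun setT (fun o =>
  fine (q (x k o))).
  move=> cq; have mq := measurableT_comp (lsc_measurable _ cq) mx.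
  have mfine : measurable_fun [set: \bar R] (@fine R) by exact: fine_measurable.
  exact: (measurableT_comp mfine mq).
by apply: measurable_funD; apply: mfine; [case: hfbar|case: hg].
Qed.

Let noise k o : R :=
  \sum_(l < k.+1) (inner (m l o) (v l o - xstar) - inner (W l o) (v l o - xstar)).

(** The telescoping bound involves the means [m], the dual averaging bound the samples [W]; [noise]
    is exactly the difference of the two sums. *)
Let gap_bound k o : k.+1%:R * (Fr k o - Fstar) <=
  gam k * p xstar +
  (\sum_(l < k.+1) dual_norm N (W l o) ^+ 2 / (2 * (gam l * beta)) + noise k o).
Proof.
have Sstar : S xstar by split.
have cS := @prox_dom_convex _ _ _ _ _ _ hg hPsi.
have cg := @prox_dom_convex_g _ _ _ _ _ _ hg hPsi.
have cP := @prox_dom_convex_Psi _ _ _ _ _ _ hg hPsi.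
have P0 := @prox_dom_ge0 _ _ _ _ _ _ hPsi.
have gamS l : gam l <= gam l.+1 :> R by rewrite ler_sqrt// ler_nat.
have ub := dual_averaging_bound hN cS cg cP P0 beta_gt0 (fun l => gam l)
  (fun l => W l o) (fun l => v l o) xstar k gam_gt0 gamS (fun l => v_argmin l o)
    Sstar.
have lb := quasi_monotone_bound cS cg (fun l => x l o) (fun l => v l o) erefl
  (fun l => v_step l o) (fun l => v_in l o) phi (fun l => m l o) xstar k
  (fun l z => mean_subgradient l o z) Sstar.
rewrite !big_split in ub lb; rewrite /noise sumrB /Fr /Fstar /= in ub lb *.
lra.
Qed.

Let noise_integrable k : P.-integrable setT (EFin \o noise k).
Proof.
apply: integrable_sumr => l.
exact: (integrableB measurableT (mean_inner l).1 (W_inner_integrable l)).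
Qed.

Let noise_mean k : \int[P]_o noise k o = 0.
Proof.
rewrite Rintegral_sum => [|l]; last first.
  exact: (integrableB measurableT (mean_inner l).1 (W_inner_integrable l)).
rewrite big1// => l _.
rewrite (RintegralB measurableT (mean_inner l).1 (W_inner_integrable l)).
by rewrite (mean_inner l).2 subrr.
Qed.

Let step_integrable l :
  P.-integrable setT (EFin \o (fun o => dual_norm N (W l o) ^+ 2 / (2 * (gam l *
    beta)))).
Proof.
have [_ iW] := W_square_integrable l.
by have := integrableZr measurableT (2 * (gam l * beta))^-1 iW; apply: eq_integrable.
Qed.

Let step_mean l :
  \int[P]_o (dual_norm N (W l o) ^+ 2 / (2 * (gam l * beta))) <=
  G ^+ 2 / beta * (2 * gam l)^-1.
Proof.
have [_ iW] := W_square_integrable l.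
rewrite RintegralZr//.
have -> : G ^+ 2 / beta * (2 * gam l)^-1 = G ^+ 2 / (2 * (gam l * beta)).
  by rewrite -mulrA -invfM; congr (_ / _); ring.
rewrite ler_wpM2r ?invr_ge0 ?mulr_ge0 ?(ltW (gam_gt0 l)) ?(ltW beta_gt0)//.
by rewrite -lee_fin fineK ?W_dual_bound// integrable_fin_num.
Qed.

Lemma expected_gap k :
  (\int[P]_o composite D f g (x k o) - composite D f g xstar
    <= (Psi xstar + (G ^+ 2 / beta)%:E) * (1 / gam k)%:E)%E.
Proof.
have Sstar : S xstar by split.
pose T o := gam k * p xstar +
  (\sum_(l < k.+1) dual_norm N (W l o) ^+ 2 / (2 * (gam l * beta)) + noise k o).
have icst (r : R) : P.-integrable setT (EFin \o cst r).
  exact: finite_measure_integrable_cst.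
have cstE (r : R) : \int[P]_o cst r o = r.
  by rewrite Rintegral_cst//= probability_setT mulr1.
have iD := integrable_sumr _ (index_enum 'I_k.+1) _ (fun l : 'I_k.+1 =>
  step_integrable l).
have iDn := integrableD measurableT iD (noise_integrable k).
have iT : P.-integrable setT (EFin \o T) by exact: (integrableD measurableT (icst
  _) iDn).
(* The noise has mean zero, and the error terms contribute at most [G^2 / beta] times the sum of
   [1 / (2 gam l)], itself at most [gam k]. *)
have ET : \int[P]_o T o <= gam k * (p xstar + G ^+ 2 / beta).
  rewrite (RintegralD measurableT (icst _) iDn) cstE.
  rewrite (RintegralD measurableT iD (noise_integrable k)) noise_mean addr0.
  rewrite mulrDr lerD2l Rintegral_sum//.
  apply: (@le_trans _ _ (\sum_(l < k.+1) (G ^+ 2 / beta * (2 * gam l)^-1))).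
    by apply: ler_sum => l _; exact: step_mean.
  by rewrite -mulr_sumr mulrC ler_wpM2r ?divr_ge0 ?sqr_ge0 ?(ltW beta_gt0)//
    sum_inv_sqrt_le.
have k0 : 0 < k.+1%:R :> R by [].
(* Optimality of [xstar] makes the gap nonnegative, so its absolute value is dominated by the
   integrable [T / (k + 1)]. This yields the integrability of [Fr k]. *)
have Q0 o : 0 <= Fr k o - Fstar.
  have [gx _] := x_in k o; rewrite subr_ge0.
  by have := hxstar (x k o); rewrite !compositeE// lee_fin.
have QT o : `|Fr k o - Fstar| <= k.+1%:R^-1 * T o.
  by rewrite ger0_norm// ler_pdivlMl// gap_bound.
have iZ : P.-integrable setT (EFin \o (fun o => k.+1%:R^-1 * T o)).
  exact: (integrableZl measurableT _ iT).
have iQ : P.-integrable setT (EFin \o (fun o => Fr k o - Fstar)).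
  by apply: integrable_le QT iZ; exact: measurable_funB.
have iF : P.-integrable setT (EFin \o Fr k).
  have := integrableD measurableT iQ (icst Fstar).
  by apply: eq_integrable => // o _ /=; rewrite -EFinD subrK.
have EQ : \int[P]_o Fr k o - Fstar <= k.+1%:R^-1 * \int[P]_o T o.
  rewrite -[X in _ - X]cstE -(RintegralB measurableT iF (icst _)).
  rewrite -(RintegralZl _ measurableT iT).
  by apply: le_Rintegral => // o _; apply: le_trans (QT o); exact: ler_norm.
rewrite (eq_integral (EFin \o Fr k)) => [|o _]; last first.
  by rewrite compositeE//; case: (x_in k o).
rewrite -(fineK (integrable_fin_num measurableT iF)) compositeE//.
rewrite (prox_dom_PsiE hPsi _ Sstar) -EFinD -EFinM lee_fin.
apply: (le_trans EQ); rewrite ler_pdivrMl//.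
apply: (le_trans ET); rewrite mul1r.
have g0 := gam_gt0 k.
(* The factor [gam k / (k + 1)] becomes [1 / gam k]. *)
have kE : k.+1%:R = gam k * gam k :> R by rewrite -expr2 sqr_sqrtr.
move: (gam k) g0 kE => r r0 ->.
by rewrite mulrA ler_pdivlMr// mulrAC.
Qed.

End convergence.

Theorem corollary1 (R : realType) (n : nat)
  (d d' : measure_display) (Xi : measurableType d) (Omega : measurableType d')
  (D : probability Xi R) (P : probability Omega R)
  (N : 'rV[R]_n -> R)
  (f : 'rV[R]_n -> Xi -> \bar R) (g Psi : 'rV[R]_n -> \bar R)
  (sigma beta G : R)
  (w : 'rV[R]_n -> Xi -> 'rV[R]_n)
  (xi : nat -> {RV P >-> Xi})
  (x : nat -> Omega -> 'rV[R]_n)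
  (xstar : 'rV[R]_n)
  (hN : is_norm N)
  (hf : forall z, closed_convex (f^~ z))
  (hfm : forall y, measurable_fun [set: Xi] (f y))
  (hfbar : closed_convex (expected_fun D f))
  (hg : closed_convex g)
  (hdom : {ae D, forall z, dom (f^~ z) `<=` dom g})
  (hdomg : closed (dom g))
  (hsigma : 0 <= sigma)
  (hgs : strongly_convex_on N (dom g) sigma g)
  (hw : subgradient_oracle D (expected_fun D f) g w)
  (hPsi : prox_function N g beta Psi)
  (hxi : iid_samples D xi)
  (hx : forall omega, RQM (fun _ => 1) (fun k => Num.sqrt k.+1%:R) g Psi w
          (fun k => xi k omega) (fun k => x k omega))
  (hxstar_dom : dom g xstar)
  (hxstar : minimizer (composite D f g) xstar)
  (hG : 0 < G)
  (hwG : forall y, dom (expected_fun D f) y ->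
    ('E_D[fun z => (dual_norm N (w y z) ^+ 2)%R] <= (G ^+ 2)%:E)%E) :
  forall k : nat,
    (\int[P]_omega composite D f g (x k omega) - composite D f g xstar
      <= (Psi xstar + (G ^+ 2 / beta)%:E) * (1 / Num.sqrt k.+1%:R)%:E)%E.
Proof.
(* If [Psi xstar] is infinite, so is the right-hand side; otherwise [xstar] lies in [prox_dom] and
   can serve as comparison point. *)
move=> k; have [PyE|Pfin] := eqVneq (Psi xstar) +oo%E.
  by rewrite PyE addye// gt0_mulye ?leey// lte_fin divr_gt0// sqrtr_gt0.
have domPsi : dom Psi xstar by rewrite /dom /= ltey.
exact: (expected_gap hN hfbar hg hdomg hw hPsi hxi hx hxstar_dom domPsi hxstar hwG).
Qed.
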